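(* Let $f:\mathbb{Z}_+\to[0,\infty)$ be a function with $f(n)\log^2 n\to 0$ as $n\to\infty$. For every $\varepsilon\in(0,1/2)$ there exist $n_0\in\mathbb{Z}_+$ and $\delta=\delta(\varepsilon)>0$ such that the following holds. Let $G$ be a graph with $n\ge n_0$ vertices, $m\ge(1-f(n))n^2/2$ edges, and maximum density $\rho(G)=m/n$. If $$k\ge(1+\delta)\sqrt{\frac{\rho(G)}{\log\rho(G)}},$$ then with probability at least $1-\varepsilon$, $G$ is conflict $\{c_v\}$-colorable for a random local $k$-partition $\{c_v\}$ of $G$.
   Context: For a graph $G$ and vertex $v$, $E(v)$ is the set of edges incident with $v$. A local $k$-partition of $G$ is a collection $\{c_v\}$ of maps $c_v:E(v)\to\{1,\dots,k\}$; $G$ is conflict $\{c_v\}$-colorable if there is $\varphi:V(G)\to\{1,\dots,k\}$ such that no edge $e=xy$ has $\varphi(x)=c_x(e)$ and $\varphi(y)=c_y(e)$. A random local $k$-partition is obtained by choosing, for each edge $e=xy$, the pair $(c_x(e),c_y(e))$ uniformly at random from $[k]^2$, independently over edges. The maximum density is $\rho(G)=\max\{|E(G')|/|V(G')|:\emptyset\ne G'\subseteq G\}$. $\log$ is the natural logarithm. *)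

(* Defs.v *)
From HB Require Import structures.
From mathcomp Require Import all_boot all_order all_algebra.
From mathcomp Require Import all_classical all_reals all_analysis.
Set Implicit Arguments. Unset Strict Implicit. Unset Printing Implicit Defensive.
Import Order.TTheory GRing.Theory Num.Theory.
Local Open Scope ring_scope.

Definition simple_graph (V : finType) (adj : rel V) : Prop :=
  symmetric adj /\ irreflexive adj.

Definition edges (V : finType) (adj : rel V) : {set {set V}} :=
  [set [set x; y] | x in V, y in V & adj x y].

(* Maximum density rho(G) = max { |E(G')| / |V(G')| : G' nonempty subgraph },
   a subgraph G' = (S, F) with S nonempty, F a set of edges of G with both
   endpoints in S.  All ratios are >= 0, so 0 is a harmless default for max. *)
Definition max_density (R : realType) (V : finType) (adj : rel V) : R :=
  \big[Num.max/0]_(S : {set V} | S != finset.set0)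
    \big[Num.max/0]_(F : {set {set V}} |
        (F \subset edges adj) && [forall f in F, f \subset S])
      (#|F|%:R / #|S|%:R).

(* Darts (x,y) with x ~ y: the incidence of vertex x with edge xy.
   A local k-partition {c_v} is c : {ffun dart -> 'I_k}, with
   c (x,y) = c_x(xy).  Choosing (c_x(e), c_y(e)) uniformly from [k]^2,
   independently over edges, is exactly the uniform distribution on
   such functions. *)
Definition dart (V : finType) (adj : rel V) := {p : V * V | adj p.1 p.2}.

Definition conflict_colorable (V : finType) (adj : rel V) (k : nat)
  (c : {ffun {p : V * V | adj p.1 p.2} -> 'I_k}) : Prop :=
  exists phi : V -> 'I_k,
    forall (x y : V) (hxy : adj x y) (hyx : adj y x),
      ~ (phi x = c (exist _ (x, y) hxy) /\ phi y = c (exist _ (y, x) hyx)).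

Definition prob_colorable (R : realType) (V : finType) (adj : rel V) (k : nat) : R :=
  #|[set c : {ffun {p : V * V | adj p.1 p.2} -> 'I_k} |
        `[< conflict_colorable c >] ]|%:R
  / #|{: {ffun {p : V * V | adj p.1 p.2} -> 'I_k}}|%:R.

(* Main.v *)
(* The choice delta = 7 works for every eps.  Let X count the maps
   phi : V -> [k] compatible with the random labels, and p = 1/k.  Cauchy-Schwarz gives
   P(X > 0) >= (E X)^2 / E X^2, and
     E X^2 / (E X)^2 <= E exp(- p^4 m + (p^2 + 4 p^4) s^2 / 2)
   where s is the number of vertices on which two independent uniform maps agree, a
   Binomial(n, p) variable: e edges inside the agreement set contribute e <= s^2 / 2.  At the
   mean s = np the exponent is O(f(n) log^2 n) + o(1).  Fluctuations of s are controlled by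
   the moment generating function alone, separately for s <= T and s > T, T = n^(5/8). *)
Require Import Defs.
From HB Require Import structures.
From mathcomp Require Import all_boot all_order all_algebra.
From mathcomp Require Import all_classical all_reals all_analysis.
From mathcomp Require Import ring lra.
Import Order.TTheory GRing.Theory Num.Theory.
Import numFieldNormedType.Exports.
Local Open Scope ring_scope.

(** * Cauchy-Schwarz in counting form *)

(** Exchanging sums produces the first and second moments of [X c], the number of [f] good for [c].
    Since [X] vanishes outside the set [A] of those [c] with some good [f], Cauchy-Schwarz on [A]
    gives the unnormalised form of P(X > 0) >= (E X)^2 / E X^2. *)
Lemma second_moment (C P : finType) (good : C -> P -> bool) :
  ((\sum_(f : P) #|[set c | good c f]|) ^ 2 <=
    #|[set c | [exists f, good c f]]| *
      \sum_(f : P) \sum_(g : P) #|[set c | good c f && good c g]|)%N.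
Proof.
pose X c := (\sum_(f : P) good c f)%N.
pose A := [set c | [exists f, good c f]].
have cardE (Q : pred C) : #|[set c | Q c]| = (\sum_c Q c)%N.
  rewrite cardsE -sum1_card big_mkcond /=.
  by apply: eq_bigr => c _; rewrite unfold_in; case: (Q c).
have X0 c : c \notin A -> X c = 0%N.
  rewrite inE negb_exists => /forallP h; apply: big1 => f _.
  by rewrite (negbTE (h f)).
have sumA (F : C -> nat) : (forall c, c \notin A -> F c = 0%N) ->
    (\sum_c F c = \sum_(c in A) F c)%N.
  move=> F0; rewrite (bigID (mem A)) /= [X in (_ + X)%N]big1 ?addn0 //.
have -> : (\sum_(f : P) #|[set c | good c f]| = \sum_(c in A) X c)%N.
  rewrite -sumA // /X exchange_big; apply: eq_bigr => f _; exact: cardE.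
have -> : (\sum_(f : P) \sum_(g : P) #|[set c | good c f && good c g]|
           = \sum_(c in A) X c ^ 2)%N.
  rewrite -sumA => [|c /X0 ->//].
  under eq_bigr => f _ do (under eq_bigr => g _ do rewrite cardE).
  under eq_bigr => f _ do rewrite exchange_big.
  rewrite exchange_big; apply: eq_bigr => c _.
  rewrite -mulnn {1}/X big_distrl; apply: eq_bigr => f _.
  rewrite /X big_distrr; apply: eq_bigr => g _.
  by case: (good c f); case: (good c g).
(* After doubling, both sides are sums over pairs [c], [d] in [A], compared termwise by 2ab <= a^2 +
   b^2. *)
rewrite -/A -(leq_pmul2l (isT : 0 < 2)%N).
have -> : (2 * (#|A| * \sum_(c in A) X c ^ 2) =
   \sum_(c in A) \sum_(d in A) (X c ^ 2 + X d ^ 2))%N.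
  under [RHS]eq_bigr => c _ do rewrite big_split sum_nat_const.
  by rewrite big_split /= -big_distrr /= sum_nat_const addnn mul2n.
rewrite -mulnn big_distrl big_distrr /=; apply: leq_sum => c _.
rewrite big_distrr big_distrr /=; apply: leq_sum => d _; exact: nat_Cauchy.
Qed.

Lemma card_ffun_in (aT rT : finType) (F : aT -> {set rT}) :
  #|[set g : {ffun aT -> rT} | [forall x, g x \in F x]]| =
  (\prod_x #|F x|)%N.
Proof.
rewrite cardsE -(eq_card (A := family (fun x => mem (F x)))) => [|g] //.
by rewrite card_family foldrE big_map big_enum.
Qed.

(** * Reduction from dart labels to independent pairs of labels on oriented edges *)

Section Orientation.
Variables (V : finType) (adj : rel V).
Hypothesis adj_simple : simple_graph adj.

(* Each edge yields exactly one arrow, so the pairs of labels along arrows are independent. *)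
Definition arrow := {p : V * V | adj p.1 p.2 && (enum_rank p.1 < enum_rank p.2)%N}.

Definition conflict_free {k : nat} (g : {ffun arrow -> 'I_k * 'I_k})
    (phi : {ffun V -> 'I_k}) : bool :=
  [forall h : arrow, g h != (phi (val h).1, phi (val h).2)].

Lemma arrow_dart (h : arrow) : adj (val h).1 (val h).2.
Proof. by case/andP: (valP h). Qed.

Lemma arrow_rdart (h : arrow) : adj (val h).2 (val h).1.
Proof. by rewrite (proj1 adj_simple) arrow_dart. Qed.

Definition arrow_labels {k : nat} (c : {ffun {p : V * V | adj p.1 p.2} -> 'I_k}) :
    {ffun arrow -> 'I_k * 'I_k} :=
  [ffun h : arrow => (c (exist _ ((val h).1, (val h).2) (arrow_dart h)),
                    c (exist _ ((val h).2, (val h).1) (arrow_rdart h)))].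

Lemma arrow_total {x y : V} : adj x y ->
  (enum_rank x < enum_rank y)%N || (enum_rank y < enum_rank x)%N.
Proof.
move=> xy; rewrite -neq_ltn; apply: contraL xy => /eqP/val_inj/enum_rank_inj ->.
by rewrite (proj2 adj_simple).
Qed.

(** Every dart is an arrow or the reverse of one, never both, so the labels read along arrows
    determine all labels. *)
Lemma arrow_labels_bij {k : nat} : (0 < k)%N -> bijective (@arrow_labels k).
Proof.
(* [i0] is a default for the branch where neither a dart nor its reverse is an arrow; [arrow_total]
   rules that branch out. *)
move=> k0; pose i0 := Ordinal k0.
exists (fun g : {ffun arrow -> 'I_k * 'I_k} => [ffun d : {p : V * V | adj p.1 p.2} =>
    if insub (val d) is Some h then (g h).1 else
    if insub ((val d).2, (val d).1) is Some h then (g h).2 else i0]).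
- move=> c; apply/ffunP => -[[x y] xy]; rewrite ffunE /=.
  case: insubP => [[[x' y'] h] _ /= [ex ey] | nxy].
    rewrite ffunE /=; congr (c _); apply: val_inj => /=; congruence.
  case: insubP => [[[x' y'] h] _ /= [ex ey] | nyx].
    rewrite ffunE /=; congr (c _); apply: val_inj => /=; congruence.
  move: nxy nyx; rewrite /= xy (proj1 adj_simple y x) xy /=.
  by move: (arrow_total xy) => /orP[->|->].
- move=> g; apply/ffunP => h; rewrite !ffunE /=.
  case: h => -[x y] /= hxy; case/andP: (hxy) => xy lxy.
  rewrite insubT; case: insubP => [[[x' y'] h] hh /= [ex ey] | _] /=.
    by move: hh; rewrite /= ltnNge (ltnW lxy) andbF.
  by rewrite -surjective_pairing.
Qed.

Lemma conflict_colorableE (k : nat) (c : {ffun {p : V * V | adj p.1 p.2} -> 'I_k}) :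
  `[< conflict_colorable c >] = [exists phi, conflict_free (arrow_labels c) phi].
Proof.
apply/asboolP/existsP => [[phi hphi] | [phi /forallP hphi]].
  exists (finfun phi); apply/forallP => h; rewrite !ffunE.
  by apply/eqP => -[e1 e2]; apply: (hphi _ _ (arrow_dart h) (arrow_rdart h)).
exists phi => x y xy yx [e1 e2].
have /orP[lxy | lyx] := arrow_total xy.
  have hxy : adj (x, y).1 (x, y).2 && (enum_rank (x, y).1 < enum_rank (x, y).2)%N.
    by rewrite xy.
  move: (hphi (Sub (x, y) hxy)); rewrite ffunE => /eqP; apply; congr pair => /=.
    by rewrite e1; congr (c _); apply: val_inj.
  by rewrite e2; congr (c _); apply: val_inj.
have hyx : adj (y, x).1 (y, x).2 && (enum_rank (y, x).1 < enum_rank (y, x).2)%N.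
  by rewrite yx.
move: (hphi (Sub (y, x) hyx)); rewrite ffunE => /eqP; apply; congr pair => /=.
  by rewrite e2; congr (c _); apply: val_inj.
by rewrite e1; congr (c _); apply: val_inj.
Qed.

(** The bijection carries uniform dart labels to a uniform pair of labels on each arrow, with
    [k ^ 2] choices per arrow. *)
Lemma prob_colorable_arrows (R : realType) (k : nat) : (0 < k)%N ->
  prob_colorable R adj k =
    #|[set g : {ffun arrow -> 'I_k * 'I_k} | [exists phi, conflict_free g phi]]|%:R
      / ((k ^ 2) ^ #|{: arrow}|)%N%:R.
Proof.
move=> k0; have bij := arrow_labels_bij k0.
rewrite /prob_colorable (bij_eq_card bij) card_ffun card_prod card_ord.
rewrite -(on_card_preimset (onW_bij _ bij)); congr (_%:R / _).
apply: eq_card => c; rewrite !inE; exact: conflict_colorableE.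
Qed.

(** Taking endpoints maps the arrows onto the edges. A lower bound on the number of edges thus
    passes to the number of arrows. *)
Lemma card_edges_le_arrows : (#|edges adj| <= #|{: arrow}|)%N.
Proof.
pose e (h : arrow) := [set (val h).1; (val h).2].
apply: leq_trans (leq_imset_card e predT); apply: subset_leq_card.
apply/fintype.subsetP => _ /imset2P[x y _ yP ->].
have xy : adj x y by move: yP; rewrite !inE.
apply/imsetP; case/orP: (arrow_total xy) => lt.
  have h : adj (x, y).1 (x, y).2 && (enum_rank (x, y).1 < enum_rank (x, y).2)%N.
    by rewrite xy.
  by exists (Sub (x, y) h).
have h : adj (y, x).1 (y, x).2 && (enum_rank (y, x).1 < enum_rank (y, x).2)%N.
  by rewrite (proj1 adj_simple) xy.
by exists (Sub (y, x) h) => //; rewrite finset.setUC.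
Qed.


(** The arrows inside [A] and their reverses are disjoint subsets of [A] x [A], since the rank
    increases along an arrow. *)
Lemma agreeing_arrows_le (A : {set V}) :
  (#|[set h : arrow | ((val h).1 \in A) && ((val h).2 \in A)]|.*2 <= #|A| ^ 2)%N.
Proof.
set B := [set h : arrow | _].
pose d (h : arrow) := ((val h).1, (val h).2).
pose r (h : arrow) := ((val h).2, (val h).1).
have dI : injective d by move=> h h' [e1 e2]; apply/val_inj/eqP; rewrite -pair_eqE /= e1 e2 !eqxx.
have rI : injective r by move=> h h' [e1 e2]; apply/val_inj/eqP; rewrite -pair_eqE /= e1 e2 !eqxx.
have disj : [disjoint d @: B & r @: B].
  apply/pred0P => p /=; apply/negP => /andP[/imsetP[h _ ->] /imsetP[h' _ [e1 e2]]].
  case/andP: (valP h) => _; case/andP: (valP h') => _; rewrite e1 e2 => l1 l2.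
  by move: (ltn_trans l1 l2); rewrite ltnn.
rewrite -addnn -{1}(card_imset B dI) -(card_imset B rI) -cardsUI.
rewrite (disjoint_setI0 disj) cards0 addn0 -mulnn -cardsX.
apply: subset_leq_card; apply/fintype.subsetP => p.
by rewrite inE => /orP[] /imsetP[h]; rewrite inE => /andP[h1 h2] ->;
   rewrite inE /= h1 h2.
Qed.

End Orientation.

(** * Elementary bounds on the exponential *)

Section Analysis.
Context {R : realType}.
Implicit Types x y : R.

Lemma expR_le_inv x : x < 1 -> expR x <= (1 - x)^-1.
Proof.
move=> x1; rewrite -[x in expR x]opprK expRN lef_pV2 ?posrE ?expR_gt0 ?subr_gt0 //.
exact: expR_ge1Dx.
Qed.

Lemma expR_le1D2x x : 0 <= x -> x <= 1 / 2 -> expR x <= 1 + 2 * x.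
Proof.
move=> x0 x1; apply: le_trans (expR_le_inv _ _) _; first lra.
by rewrite -[_^-1]mul1r ler_pdivrMr; [nra | lra].
Qed.

(** Bounding by 1 / (1 - x) reduces this to x^2 (1 - 2x) >= 0. Negative [x] must be allowed, because
    the bound is applied at both [theta] and [- theta]. *)
Lemma expR_le1Dx_sqr x : x <= 1 / 2 -> expR x <= 1 + x + 2 * x ^+ 2.
Proof.
move=> x1; apply: le_trans (expR_le_inv _ _) _; first lra.
rewrite -[_^-1]mul1r ler_pdivrMr; last lra.
have : 0 <= x ^+ 2 * (1 - 2 * x) by apply: mulr_ge0; [exact: sqr_ge0 | lra].
rewrite expr2; lra.
Qed.

(** The bracket is the square of e^(x/2) - e^(-x/2), which is at least x/2 for x >= 0. It lets a
    second moment be bounded through moment generating functions alone. *)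
Lemma sqr_le_expRDN x : x ^+ 2 <= 4 * (expR x + expR (- x) - 2).
Proof.
wlog x0 : x / 0 <= x => [H|].
  have [/H//|x0] := lerP 0 x.
  by rewrite -sqrrN (addrC (expR x)) -{3}[x]opprK; apply: H; lra.
have -> : expR x = expR (x / 2) ^+ 2 by rewrite -expRM_natl mulrC divfK.
have -> : expR (- x) = expR (- (x / 2)) ^+ 2.
  by rewrite -expRM_natl mulrN mulrC divfK.
have e1 : expR (x / 2) * expR (- (x / 2)) = 1 by rewrite expRxMexpNx_1.
have e2 := expR_ge1Dx (x / 2).
have e3 : expR (- (x / 2)) <= 1 by rewrite expR_le1; lra.
have e4 : x / 2 <= expR (x / 2) - expR (- (x / 2)) by lra.
have e5 : (x / 2) ^+ 2 <= (expR (x / 2) - expR (- (x / 2))) ^+ 2.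
  by rewrite lerXn2r // ?nnegrE; lra.
by rewrite !expr2 in e5 *; lra.
Qed.

(* For s <= T the quadratic exponent is at most the linear exponent y when
   y >= 0; when y < 0 it suffices to bound 1 by e^y + |y|.  For s > T it is
   at most lam * n * s / 2. *)
Lemma expR_quadratic_le (lam n mu T eta s theta y : R) :
  0 <= lam -> 0 <= mu -> 0 <= T -> 0 < eta -> 0 <= s -> s <= n ->
  theta = lam * (T + mu) / 2 -> y = theta * (s - mu) ->
  expR (lam * s ^+ 2 / 2 - lam * mu ^+ 2 / 2) <=
    expR y + eta + 4 * (expR y + expR (- y) - 2) / eta
    + expR ((lam * n / 2 + 1) * s - T).
Proof.
move=> lam0 mu0 T0 eta0 s0 sn thetaE yE.
have qy := sqr_le_expRDN y.
have q0 : 0 <= 4 * (expR y + expR (- y) - 2) / eta.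
  by rewrite divr_ge0 ?(ltW eta0) // (le_trans _ qy) // sqr_ge0.
have yp := expR_gt0 y.
have tp := expR_gt0 ((lam * n / 2 + 1) * s - T).
(* For s > T the added [s - T] is positive; the term - T is what makes the average of this
   exponential small. *)
have [sT | Ts] := lerP s T; last first.
  suff : expR (lam * s ^+ 2 / 2 - lam * mu ^+ 2 / 2) <=
    expR ((lam * n / 2 + 1) * s - T) by lra.
  rewrite ler_expR.
  have : 0 <= lam * mu ^+ 2 by rewrite mulr_ge0 ?sqr_ge0.
  have : lam * s * s <= lam * s * n by rewrite ler_wpM2l ?mulr_ge0.
  rewrite !expr2; lra.
have thp : 0 <= theta by rewrite thetaE divr_ge0 ?mulr_ge0 ?addr_ge0.
have eq2 : lam * s ^+ 2 / 2 - lam * mu ^+ 2 / 2 = lam * (s + mu) / 2 * (s - mu).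
  by field.
have [ms | sm] := lerP mu s.
  suff : expR (lam * s ^+ 2 / 2 - lam * mu ^+ 2 / 2) <= expR y by lra.
  rewrite ler_expR eq2 yE thetaE ler_wpM2r ?subr_ge0 //.
  by rewrite ler_pM2r ?invr_gt0 // ler_wpM2l // lerD2r.
have le1 : expR (lam * s ^+ 2 / 2 - lam * mu ^+ 2 / 2) <= 1.
  rewrite expR_le1 eq2 mulr_ge0_le0 ?subr_le0 ?(ltW sm) //.
  by rewrite divr_ge0 ?mulr_ge0 ?addr_ge0.
have y0 : y <= 0 by rewrite yE mulr_ge0_le0 // subr_le0 ltW.
have ey := expR_ge1Dx y.
(* Splitting at - y = eta turns |y| into a small constant plus a multiple of y^2, which [qy]
   controls. *)
have : - y <= eta + y ^+ 2 / eta.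
  have [|yeta] := lerP (- y) eta.
    by move=> h; rewrite (le_trans h) // lerDl divr_ge0 ?sqr_ge0 ?ltW.
  apply: (@le_trans _ _ (y ^+ 2 / eta)); last by rewrite lerDr ltW.
  rewrite ler_pdivlMr // -sqrrN expr2 ler_wpM2l; lra.
have : y ^+ 2 / eta <= 4 * (expR y + expR (- y) - 2) / eta.
  by rewrite ler_pM2r ?invr_gt0.
lra.
Qed.

End Analysis.

(** * Exponential moments of the size of the agreement set *)

Section SecondMoment.
Variables (R : realType) (V : finType) (k : nat).
Hypothesis k_gt0 : (0 < k)%N.
Let n := #|V|.

Definition agree (phi psi : {ffun V -> 'I_k}) : {set V} :=
  [set v | phi v == psi v].

(** For fixed [phi] the sum over [psi] factors over the vertices: at each one, a single colour
    agrees and the other k - 1 do not. *)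
Lemma agree_mgf (theta : R) :
  \sum_(phi : {ffun V -> 'I_k}) \sum_(psi : {ffun V -> 'I_k})
    expR (theta * #|agree phi psi|%:R)
  = k%:R ^+ n * (k%:R - 1 + expR theta) ^+ n.
Proof.
have step (phi : {ffun V -> 'I_k}) :
    \sum_(psi : {ffun V -> 'I_k}) expR (theta * #|agree phi psi|%:R)
    = (k%:R - 1 + expR theta) ^+ n.
  rewrite (eq_bigr (fun psi : {ffun V -> 'I_k} =>
      \prod_v expR (theta * (phi v == psi v)%:R))); last first.
    move=> psi _; rewrite -expR_sum -mulr_sumr; congr (expR (_ * _)).
    rewrite -natr_sum; congr (_%:R); rewrite -sum1_card big_mkcond.
    by apply: eq_bigr => v _; rewrite inE; case: eqP.
  rewrite -(bigA_distr_bigA (fun v b => expR (theta * (phi v == b)%:R))).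
  rewrite (eq_bigr (fun=> k%:R - 1 + expR theta)) ?prodr_const //.
  move=> v _; rewrite (bigD1 (phi v)) //= eqxx mulr1 addrC; congr (_ + _).
  rewrite (eq_bigr (fun=> 1)) => [|b]; last first.
    by rewrite eq_sym => /negbTE ->; rewrite mulr0 expR0.
  rewrite sumr_const cardC1 card_ord -subn1 natrB //.
rewrite (eq_bigr _ (fun phi _ => step phi)) sumr_const card_ffun card_ord.
by rewrite -[LHS]mulr_natl natrX.
Qed.

Lemma agree_mgf_le (theta : R) :
  \sum_(phi : {ffun V -> 'I_k}) \sum_(psi : {ffun V -> 'I_k})
    expR (theta * #|agree phi psi|%:R)
  <= k%:R ^+ (2 * n) * expR (n%:R / k%:R * (expR theta - 1)).
Proof.
have k0 : 0 < k%:R :> R by rewrite ltr0n.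
rewrite agree_mgf mul2n -addnn exprD -mulrA.
apply: ler_wpM2l; first exact/exprn_ge0/ltW.
have -> : k%:R - 1 + expR theta = k%:R * (1 + (expR theta - 1) / k%:R).
  by rewrite mulrDr mulr1 mulrCA divff ?gt_eqF // mulr1 -addrA (addrC (-1)).
rewrite exprMn; apply: ler_wpM2l; first exact/exprn_ge0/ltW.
have -> : n%:R / k%:R * (expR theta - 1) = n%:R * ((expR theta - 1) / k%:R).
  by rewrite mulrAC mulrA.
rewrite expRM_natl lerXn2r ?nnegrE ?expR_ge0 ?expR_ge1Dx //.
(* Monotonicity of the n-th power needs a nonnegative base; here the base exceeds 1 - 1/k. *)
have k1 : 1 <= k%:R :> R by rewrite ler1n.
have h : (- 1) / k%:R <= (expR theta - 1) / k%:R.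
  by rewrite ler_pM2r ?invr_gt0 //; have := expR_gt0 theta; lra.
have : k%:R^-1 <= 1 :> R by rewrite invf_le1.
by move: h; rewrite mulN1r; lra.
Qed.

End SecondMoment.

(** This sums [expR_quadratic_le] over all pairs of maps: [D] bounds the centred exponential moments
    at [theta] and [- theta], and the last exponential bounds the tail beyond [T]. *)
Lemma agree_quadratic_le (R : realType) (V : finType) (k : nat)
    (lam eta T theta mu D : R) :
  (0 < k)%N -> 0 <= lam -> 0 < eta -> 0 <= T ->
  mu = #|V|%:R / k%:R -> theta = lam * (T + mu) / 2 -> theta <= 1 / 2 ->
  D = expR (2 * mu * theta ^+ 2) ->
  \sum_(phi : {ffun V -> 'I_k}) \sum_(psi : {ffun V -> 'I_k})
    expR (lam * #|agree V k phi psi|%:R ^+ 2 / 2) <=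
  (k%:R ^+ (2 * #|V|) * expR (lam * mu ^+ 2 / 2) *
   (D + eta + 8 * (D - 1) / eta
    + expR (mu * (expR (lam * #|V|%:R / 2 + 1) - 1) - T)) : R).
Proof.
move=> k0 lam0 eta0 T0 muE thetaE theta_le DE.
pose n := #|V|; pose K : R := k%:R ^+ (2 * n).
pose S (F : R -> R) := \sum_(phi : {ffun V -> 'I_k})
  \sum_(psi : {ffun V -> 'I_k}) F #|agree V k phi psi|%:R.
have SD F G : S (fun s => F s + G s) = S F + S G.
  by rewrite /S -big_split; apply: eq_bigr => phi _; rewrite -big_split.
have SZ c F : S (fun s => c * F s) = c * S F.
  by rewrite /S mulr_sumr; apply: eq_bigr => phi _; rewrite mulr_sumr.
(* An equality is required, since it is applied to eta - 8 / eta, which may be negative. *)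
have S1 c : S (fun=> c) = c * K.
  rewrite /S !sumr_const card_ffun card_ord -mulrnA -[LHS]mulr_natr.
  by rewrite natrM natrX -exprD addnn -mul2n.
have Sle (F G : R -> R) : (forall s, 0 <= s -> s <= n%:R -> F s <= G s) -> S F <= S G.
  move=> FG; apply: ler_sum => phi _; apply: ler_sum => psi _.
  by apply: FG => //; rewrite ler_nat max_card.
have mu0 : 0 <= mu by rewrite muE divr_ge0.
have theta0 : 0 <= theta by rewrite thetaE divr_ge0 ?mulr_ge0 ?addr_ge0.
have K0 : 0 < K by rewrite exprn_gt0 // ltr0n.
have mgf t : S (fun s => expR (t * s)) <= K * expR (mu * (expR t - 1)).
  by rewrite muE; apply: agree_mgf_le.
(* Centring at [mu] cancels the linear part of mu (e^t - 1) and leaves at most 2 mu t^2, the same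
   for both signs of t. *)
have Sy t : t <= 1 / 2 -> t ^+ 2 = theta ^+ 2 ->
    S (fun s => expR (t * (s - mu))) <= K * D.
  move=> t2 tth.
  have -> : S (fun s => expR (t * (s - mu))) =
      expR (- (t * mu)) * S (fun s => expR (t * s)).
    rewrite -SZ; congr S; apply/funext => s.
    by rewrite -expRD; congr expR; ring.
  apply: (@le_trans _ _ (expR (- (t * mu)) * (K * expR (mu * (expR t - 1))))).
    by rewrite ler_wpM2l ?expR_ge0.
  rewrite mulrCA -expRD; apply: ler_wpM2l; first exact: ltW.
  have h := ler_wpM2l mu0 (expR_le1Dx_sqr _ t2); rewrite tth in h.
  by rewrite DE ler_expR; lra.
have Sp := Sy theta theta_le erefl.
have Sn : S (fun s => expR (- (theta * (s - mu)))) <= K * D.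
  have := Sy (- theta); rewrite sqrrN => /(_ _ erefl).
  have -> : (fun s => expR (- theta * (s - mu))) =
    (fun s => expR (- (theta * (s - mu)))).
    by apply/funext => s; rewrite mulNr.
  by apply; lra.
pose a := lam * n%:R / 2 + 1.
have Sa : S (fun s => expR (a * s - T)) <= K * expR (mu * (expR a - 1) - T).
  have -> : S (fun s => expR (a * s - T)) = expR (- T) * S (fun s => expR (a * s)).
    by rewrite -SZ; congr S; apply/funext => s; rewrite -expRD addrC.
  rewrite [mu * _ - T]addrC expRD mulrCA.
  by apply: ler_wpM2l; [exact: expR_ge0 | exact: mgf].
apply: (@le_trans _ _ (expR (lam * mu ^+ 2 / 2) * S (fun s =>
    (1 + 4 / eta) * expR (theta * (s - mu))
    + ((4 / eta) * expR (- (theta * (s - mu)))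
    + ((eta - 8 / eta) + expR (a * s - T)))))).
  rewrite -SZ; apply: (Sle (fun s => expR (lam * s ^+ 2 / 2))) => s s0 sn.
  rewrite -[lam * s ^+ 2 / 2](subrK (lam * mu ^+ 2 / 2)) addrC expRD.
  apply: ler_wpM2l; first exact: expR_ge0.
  have := expR_quadratic_le lam n%:R mu T eta s theta _ lam0 mu0 T0 eta0 s0 sn
    thetaE erefl.
  move=> /le_trans; apply.
  by rewrite le_eqVlt; apply/orP; left; apply/eqP; rewrite /a; field; rewrite gt_eqF.
rewrite -/n -/K [K * _]mulrC -[leRHS]mulrA; apply: ler_wpM2l; first exact: expR_ge0.
rewrite !SD !S1 !SZ -mulrDl.
have e1 : 0 <= 1 + 4 / eta by rewrite addr_ge0 ?divr_ge0 ?(ltW eta0).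
have e2 : 0 <= 4 / eta by rewrite divr_ge0 ?(ltW eta0).
have := ler_wpM2l e1 Sp; have := ler_wpM2l e2 Sn; move: Sa.
rewrite -/K -/n -/a => h1 h2 h3.
have -> : K * (D + eta + 8 * (D - 1) / eta + expR (mu * (expR a - 1) - T)) =
  (1 + 4 / eta) * (K * D) + (4 / eta * (K * D) + ((eta - 8 / eta) * K
     + K * expR (mu * (expR a - 1) - T))).
  by field; rewrite gt_eqF.
by apply: lerD => //; apply: lerD => //; apply: lerD.
Qed.


(** * From counts of jointly compatible labels to the colouring probability *)

Section ColoringProbability.
Variables (R : realType) (V : finType) (adj : rel V).
Hypothesis adj_simple : simple_graph adj.

Lemma card_conflict_free {k : nat} (phi : {ffun V -> 'I_k}) :
  #|[set g | conflict_free V adj g phi]| = ((k ^ 2 - 1) ^ #|{: arrow V adj}|)%N.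
Proof.
pose F (h : arrow V adj) := ~: [set (phi (val h).1, phi (val h).2)].
transitivity (\prod_h #|F h|)%N; last first.
  rewrite (eq_bigr (fun=> (k ^ 2 - 1)%N)) ?prod_nat_const // => h _.
  by rewrite cardsC1 card_prod card_ord -subn1.
rewrite -card_ffun_in; apply: eq_card => g; rewrite !inE.
by apply: eq_forallb => h; rewrite !inE.
Qed.

Lemma card_conflict_free2 {k : nat} (phi psi : {ffun V -> 'I_k}) :
  #|[set g | conflict_free V adj g phi && conflict_free V adj g psi]| =
  (\prod_(h : arrow V adj)
     #|~: [set (phi (val h).1, phi (val h).2); (psi (val h).1, psi (val h).2)]|)%N.
Proof.
rewrite -card_ffun_in; apply: eq_card => g; rewrite !inE.
apply/andP/forallP => [[/forallP h1 /forallP h2] h | H].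
  by rewrite !inE negb_or h1 h2.
by split; apply/forallP => h; move: (H h); rewrite !inE negb_or => /andP[].
Qed.

(** With q = p^2, a random pair of labels avoids both [a] and [b] with probability 1 - q or 1 - 2q.
    Relative to (1 - q)^2 this is at most 1 + q + 3q^2 when a = b and at most 1 - q^2 otherwise; 1 +
    x <= e^x then applies. *)
Lemma pair_weight_le {k : nat} (p : R) (a b : 'I_k * 'I_k) : (2 <= k)%N ->
  p = k%:R^-1 ->
  #|~: [set a; b]|%:R * (k ^ 2)%N%:R <=
   ((k ^ 2 - 1)%N%:R ^+ 2 *
    expR (- p ^+ 4 + (p ^+ 2 + 4 * p ^+ 4) * (a == b)%:R) : R).
Proof.
move=> k2 pE.
have k0 : 0 < k%:R :> R by rewrite ltr0n (leq_trans _ k2).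
pose q : R := p ^+ 2.
have q0 : 0 <= q by rewrite sqr_ge0.
have q4 : q <= 1 / 4.
  rewrite /q pE exprVn -[1 / 4]mul1r mulrA mulr1 mul1r lef_pV2 ?posrE ?exprn_gt0 //.
  have : 2 <= k%:R :> R by rewrite ler_nat.
  by rewrite expr2; nra.
have kq : (k ^ 2)%N%:R * q = 1 :> R.
  by rewrite /q pE exprVn natrX divff // gt_eqF ?exprn_gt0.
have kk : (2 <= k ^ 2)%N by rewrite (leq_trans k2) // -{1}(expn1 k) leq_exp2l.
have K0 : 0 <= (k ^ 2)%N%:R :> R by [].
have cE : #|~: [set a; b]|%:R = (k ^ 2)%N%:R * (1 - (2 - (a == b)%:R) * q) :> R.
  have -> : #|~: [set a; b]| = (k ^ 2 - #|[set a; b]|)%N.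
    by rewrite cardsCs finset.setCK card_prod card_ord.
  rewrite cards2 natrB; last by case: (a != b) => //=; exact: ltnW.
  by rewrite mulrBr mulr1 mulrCA kq mulr1; case: (a == b) => /=; lra.
have c1 : (k ^ 2 - 1)%N%:R = (k ^ 2)%N%:R * (1 - q) :> R.
  by rewrite natrB ?(ltnW kk) // mulrBr mulr1 kq.
rewrite cE c1 exprMn mulrAC -expr2 -[leRHS]mulrA; apply: ler_wpM2l; first exact: sqr_ge0.
have -> : p ^+ 4 = q ^+ 2 by rewrite /q -exprM.
rewrite -/q; case: (a == b) => /=.
  apply: (@le_trans _ _ ((1 - q) ^+ 2 * (1 + (q + 3 * q ^+ 2)))).
    have : 0 <= q ^+ 2 * (1 - q) * (2 - 3 * q).
      apply: mulr_ge0; last lra.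
      by apply: mulr_ge0; [exact: sqr_ge0 | lra].
    by rewrite !expr2; lra.
  apply: ler_wpM2l; first exact: sqr_ge0.
  by apply: le_trans (expR_ge1Dx _) _; rewrite ler_expR; lra.
apply: (@le_trans _ _ ((1 - q) ^+ 2 * (1 - q ^+ 2))).
  have : 0 <= q ^+ 3 * (2 - q) by apply: mulr_ge0; [exact: exprn_ge0 | lra].
  by rewrite !exprS expr0; lra.
apply: ler_wpM2l; first exact: sqr_ge0.
by apply: le_trans (expR_ge1Dx _) _; rewrite ler_expR; lra.
Qed.

(** Multiply [pair_weight_le] over arrows. The two colour pairs coincide exactly on arrows with both
    ends in the agreement set, at most s^2 / 2 of them. *)
Lemma agree_weight_le {k : nat} (p : R) (phi psi : {ffun V -> 'I_k}) : (2 <= k)%N ->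
  p = k%:R^-1 ->
  #|[set g | conflict_free V adj g phi && conflict_free V adj g psi]|%:R
    * (k ^ 2)%N%:R ^+ #|{: arrow V adj}| <=
  ((k ^ 2 - 1)%N%:R ^+ (2 * #|{: arrow V adj}|) *
   (expR (- p ^+ 4 * #|{: arrow V adj}|%:R) *
    expR ((p ^+ 2 + 4 * p ^+ 4) * #|agree V k phi psi|%:R ^+ 2 / 2)) : R).
Proof.
move=> k2 pE; set M := #|{: arrow V adj}|; set s := #|agree _ _ _ _|.
have p0 : 0 <= p by rewrite pE invr_ge0.
pose lam := p ^+ 2 + 4 * p ^+ 4.
have lam0 : 0 <= lam by rewrite addr_ge0 ?mulr_ge0 ?exprn_ge0.
pose A (h : arrow V adj) := (phi (val h).1, phi (val h).2).
pose B (h : arrow V adj) := (psi (val h).1, psi (val h).2).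
rewrite card_conflict_free2 natr_prod -prodr_const -big_split /=.
apply: (@le_trans _ _ (\prod_(h : arrow V adj) ((k ^ 2 - 1)%N%:R ^+ 2 *
    expR (- p ^+ 4 + lam * (A h == B h)%:R)))).
  by apply: ler_prod => h _; rewrite mulr_ge0 //=; exact: pair_weight_le.
rewrite big_split /= prodr_const -exprM; apply: ler_wpM2l; first exact: exprn_ge0.
rewrite -expRD -expR_sum ler_expR big_split /= sumr_const mulr_natr lerD2l.
rewrite -mulr_sumr -natr_sum -mulrA ler_wpM2l // ler_pdivlMr // -natrX -natrM ler_nat.
have -> : (\sum_h (A h == B h))%N =
  #|[set h : arrow V adj | ((val h).1 \in agree V k phi psi)
                       && ((val h).2 \in agree V k phi psi)]|.
  rewrite -[RHS]sum1_card [RHS]big_mkcond; apply: eq_bigr => h _.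
  by rewrite !inE /A /B -pair_eqE /=; case: (_ && _).
by rewrite muln2; exact: agreeing_arrows_le.
Qed.

(** The hypothesis, with [agree_weight_le], makes [Q] a bound on E X^2 / (E X)^2, so [second_moment]
    gives P(X > 0) >= 1 / Q. *)
Lemma prob_colorable_ge (k : nat) (p Q : R) : (2 <= k)%N ->
  p = k%:R^-1 ->
  0 < Q ->
  expR (- p ^+ 4 * #|{: arrow V adj}|%:R) *
  \sum_(phi : {ffun V -> 'I_k}) \sum_(psi : {ffun V -> 'I_k})
    expR ((p ^+ 2 + 4 * p ^+ 4) * #|agree V k phi psi|%:R ^+ 2 / 2)
  <= k%:R ^+ (2 * #|V|) * Q ->
  Q^-1 <= prob_colorable R adj k.
Proof.
move=> k2 pE Q0 H.
have k0 : (0 < k)%N by apply: leq_trans k2.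
rewrite (prob_colorable_arrows V adj adj_simple) //.
set M := #|{: arrow V adj}| in H *; set G := #|_|.
have := second_moment _ _ (fun g phi => @conflict_free V adj k g phi).
rewrite -/G (eq_bigr (fun=> ((k ^ 2 - 1) ^ M)%N)); last first.
  by move=> phi _; exact: card_conflict_free.
rewrite sum_nat_const card_ffun card_ord.
set S2 := (\sum_f _)%N => sm.
(* As k >= 2, the first moment is positive; hence so is [S2], which can be cancelled at the end. *)
have kk : (0 < k ^ 2 - 1)%N by rewrite subn_gt0 -{1}(exp1n 2) ltn_sqr.
have S1_gt0 : (0 < (k ^ #|V| * (k ^ 2 - 1) ^ M) ^ 2)%N.
  by rewrite expn_gt0 muln_gt0 !expn_gt0 k0 kk.
have /andP[G0 S20] : (0 < G)%N && (0 < S2)%N by rewrite -muln_gt0 (leq_trans S1_gt0).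
have key : S2%:R * (k ^ 2)%N%:R ^+ M <=
    Q * ((k ^ #|V| * (k ^ 2 - 1) ^ M) ^ 2)%N%:R :> R.
  rewrite natr_sum mulr_suml.
  apply: (@le_trans _ _ ((k ^ 2 - 1)%N%:R ^+ (2 * M) * (k%:R ^+ (2 * #|V|) * Q))); last first.
    by rewrite natrX natrM !natrX exprMn -!exprM ![(_ * 2)%N]mulnC mulrCA mulrA mulrC mulrA.
  apply: le_trans (ler_wpM2l _ H); last by rewrite exprn_ge0.
  rewrite mulr_sumr mulr_sumr; apply: ler_sum => phi _.
  rewrite natr_sum mulr_suml !mulr_sumr; apply: ler_sum => psi _.
  exact: agree_weight_le.
have : S2%:R * (k ^ 2)%N%:R ^+ M <= Q * (G%:R * S2%:R) :> R.
  apply: le_trans key _; rewrite -natrM ler_wpM2l ?ler_nat //; exact: ltW.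
rewrite mulrA [leLHS]mulrC ler_pM2r ?ltr0n // => h.
rewrite natrX ler_pdivlMr; last by rewrite exprn_gt0 // ltr0n expn_gt0 k0.
by rewrite ler_pdivrMl.
Qed.

End ColoringProbability.

(** * Numerical estimate of the second moment ratio *)

Lemma expR1_le4 (R : realType) : expR 1 <= 4 :> R.
Proof.
have -> : 1 = 2%:R * (1 / 2) :> R by lra.
rewrite expRM_natl.
have h : expR (1 / 2) <= 2 :> R.
  by have := expR_le1D2x (1 / 2 : R) _ _; lra.
have := expR_gt0 (1 / 2 : R); rewrite expr2; nra.
Qed.

(* With u = n^(1/32) every quantity is compared with a power of u:
   p <= u^-15, mu <= u^17, theta <= 2 u^-10, L <= 16 u^2. *)
Lemma second_moment_ratio_le (R : realType)
    (eps n L u p g M mu lam T theta eta D : R) :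
  0 < eps -> eps < 1 / 2 -> 0 <= L -> n = expR L -> u = expR (L / 32) ->
  1 <= (eps / 100) ^+ 2 * u -> 0 <= p -> p ^+ 2 * (16 * n) <= L ->
  0 <= g -> g * L ^+ 2 <= eps -> (1 - g) * n ^+ 2 / 2 <= M ->
  mu = n * p -> lam = p ^+ 2 + 4 * p ^+ 4 -> T = u ^+ 20 ->
  theta = lam * (T + mu) / 2 -> eta = eps / 8 ->
  D = expR (2 * mu * theta ^+ 2) ->
  theta <= 1 / 2 /\
  expR (- p ^+ 4 * M) * (expR (lam * mu ^+ 2 / 2) *
    (D + eta + 8 * (D - 1) / eta
      + expR (mu * (expR (lam * n / 2 + 1) - 1) - T))) <= 1 + eps.
Proof.
move=> e0 e1 L0 nE uE u_ge p0 pL g0 gL MM muE lamE TE thE etaE DE.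
have u0 : 0 < u by rewrite uE expR_gt0.
have uX k (x : R) : x = k%:R / 32 * L -> expR x = u ^+ k.
  by move=> ->; rewrite uE -expRM_natl; congr expR; field.
pose w := u^-1.
have w0 : 0 < w by rewrite invr_gt0.
have uw : u * w = 1 by rewrite divff // gt_eqF.
have we : w <= (eps / 100) ^+ 2.
  by have := ler_wpM2r (ltW w0) u_ge; rewrite -mulrA uw mulr1 mul1r.
have we1 : w <= eps / 10 / 100.
  by have := ler_wpM2l (ltW e0) (ltW e1); move: we; rewrite expr2; lra.
have w1 : w <= 1 / 100 by lra.
have uwX k : u ^+ k * w ^+ k = 1 by rewrite -exprMn uw expr1n.
have uwl a b : u ^+ a * w ^+ (a + b) = w ^+ b by rewrite exprD mulrA uwX mul1r.
have uwr a b : u ^+ (a + b) * w ^+ a = u ^+ b by rewrite addnC exprD -mulrA uwX mulr1.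
have wX k : w ^+ k.+1 <= w.
  by rewrite exprS ler_piMr ?(ltW w0) // exprn_ile1 ?(ltW w0) //; lra.
have u1 : 100 <= u.
  have h : 100 * w <= 1 by lra.
  by rewrite -[leRHS]mulr1 -[leLHS]mulr1 -{1}uw; nra.
have L16 : L / 16 <= u ^+ 2.
  rewrite -(uX 2%N (L / 16)); last by field.
  by apply: le_trans (expR_ge1Dx _); lra.
have n32 : n = u ^+ 32 by rewrite nE (uX 32%N) //; field.
have n0 : 0 < n by rewrite n32 exprn_gt0.
have pn : p ^+ 2 * n <= L / 16 by lra.
have pn0 : 0 <= p ^+ 2 * n by rewrite mulr_ge0 ?sqr_ge0 ?ltW.
(* p^2 n <= L / 16 <= e^(L/16) = u^2, and n = u^32. *)
have p2 : p ^+ 2 <= w ^+ 30.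
  have -> : w ^+ 30 = u ^+ 2 / n.
    apply: (mulIf (lt0r_neq0 n0)); rewrite divfK ?lt0r_neq0 //.
    by rewrite n32 mulrC (uwr 30%N 2%N).
  by rewrite ler_pdivlMr // (le_trans pn).
have p1 : p <= w ^+ 15.
  have : p ^+ 2 <= (w ^+ 15) ^+ 2 by rewrite -exprM.
  by rewrite ler_pXn2r ?nnegrE // exprn_ge0 // ltW.
have q4 : p ^+ 2 <= 1 / 4 by apply: le_trans p2 _; have := wX 29%N; lra.
have p4E : p ^+ 4 = p ^+ 2 * p ^+ 2 by rewrite -exprD.
have lam2 : lam <= 2 * p ^+ 2 by rewrite lamE p4E; have := sqr_ge0 p; nra.
have lam0 : 0 <= lam by rewrite lamE addr_ge0 ?mulr_ge0 ?exprn_ge0.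
have mu0 : 0 <= mu by rewrite muE mulr_ge0 // ltW.
have mu17 : mu <= u ^+ 17.
  rewrite muE; apply: le_trans (ler_wpM2l (ltW n0) p1) _.
  by rewrite n32 (uwr 15%N 17%N).
have T17 : u ^+ 17 <= T by rewrite TE ler_weXn2l //; lra.
have T0 : 0 <= T by rewrite TE exprn_ge0 // ltW.
have th0 : 0 <= theta by rewrite thE divr_ge0 // mulr_ge0 // addr_ge0.
have th10 : theta <= 2 * w ^+ 10.
  apply: (@le_trans _ _ (lam * T)).
    have : lam * mu <= lam * T by rewrite ler_wpM2l // (le_trans mu17).
    by rewrite thE; lra.
  apply: (@le_trans _ _ ((2 * w ^+ 30) * T)); first by rewrite ler_wpM2r //; lra.
  by rewrite TE -mulrA [w ^+ 30 * _]mulrC (uwl 20%N 10%N).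
have muth : mu * theta ^+ 2 <= 4 * w.
  apply: (@le_trans _ _ (u ^+ 17 * (2 * w ^+ 10) ^+ 2)).
    apply: ler_pM; rewrite ?sqr_ge0 //.
    by apply: lerXn2r; rewrite ?nnegrE ?mulr_ge0 ?exprn_ge0 // ltW.
  rewrite exprMn -exprM mulrCA (uwl 17%N 3%N).
  by have := wX 2%N; lra.
have D1 : 1 <= D by rewrite DE -expR0 ler_expR -mulrA !mulr_ge0 ?sqr_ge0.
have D2 : D <= 1 + 16 * w.
  rewrite DE; apply: (@le_trans _ _ (expR (8 * w))); first by rewrite ler_expR; lra.
  by have := expR_le1D2x (8 * w) _ _; lra.
split; first by apply: le_trans th10 _; have := wX 9%N; lra.
(* The positive part is at most u^17 * 4 u^2 = 4 u^19, which T = u^20 exceeds by at least u; then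
   e^(-u) <= 1 / u. *)
have tail : expR (mu * (expR (lam * n / 2 + 1) - 1) - T) <= w.
  have h1 : expR (lam * n / 2 + 1) <= 4 * u ^+ 2.
    rewrite expRD mulrC; apply: ler_pM; rewrite ?expR_ge0 //.
      exact: expR1_le4.
    rewrite -(uX 2%N (L / 16)); last by field.
    by rewrite ler_expR; have := ler_wpM2r (ltW n0) lam2; lra.
  have h2 : mu * (expR (lam * n / 2 + 1) - 1) <= u ^+ 17 * (4 * u ^+ 2).
    apply: (@le_trans _ _ (mu * (4 * u ^+ 2))); first by rewrite ler_wpM2l //; lra.
    by rewrite ler_wpM2r // mulr_ge0 ?sqr_ge0.
  have h3 : mu * (expR (lam * n / 2 + 1) - 1) - T <= - u.
    have : u <= u ^+ 19 by rewrite -[leLHS]expr1 ler_weXn2l //; lra.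
    have -> : T = u * u ^+ 19 by rewrite TE -exprS.
    have e19 : u ^+ 17 * (4 * u ^+ 2) = 4 * u ^+ 19 by rewrite mulrCA -exprD.
    rewrite e19 in h2 => u19.
    have : 5 * u ^+ 19 <= u * u ^+ 19 by apply: ler_wpM2r; [exact/exprn_ge0/ltW | lra].
    lra.
  apply: (@le_trans _ _ (expR (- u))); first by rewrite ler_expR.
  rewrite expRN /w lef_pV2 ?posrE ?expR_gt0 //.
  by apply: le_trans (expR_ge1Dx _); lra.
have brk : D + eta + 8 * (D - 1) / eta
    + expR (mu * (expR (lam * n / 2 + 1) - 1) - T) <= 1 + eps / 3.
  (* Dividing by eta = eps / 8 costs a factor 1 / eps, absorbed by the square in w <= (eps /
     100)^2. *)
  have : 8 * (D - 1) / eta <= eps / 9.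
    rewrite etaE ler_pdivrMr; last lra.
    by move: we; rewrite expr2; lra.
  by rewrite etaE; lra.
(* The main terms (p^2 n)^2 / 2 cancel. What remains is g (p^2 n)^2 / 2, of order g L^2, and 2 p^2
   (p^2 n)^2 <= 2 w. *)
have xi : - p ^+ 4 * M + lam * mu ^+ 2 / 2 <= eps / 12.
  have p40 : 0 <= p ^+ 4 by rewrite exprn_ge0.
  have h1 := ler_wpM2l p40 MM.
  have h2 : (p ^+ 2 * n) ^+ 2 <= (L / 16) ^+ 2.
    by apply: lerXn2r; rewrite ?nnegrE //; lra.
  have h3 := ler_wpM2l g0 h2.
  have h4 : p ^+ 2 * (p ^+ 2 * n) ^+ 2 <= w.
    apply: (@le_trans _ _ (w ^+ 30 * (u ^+ 2) ^+ 2)).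
      apply: ler_pM; rewrite ?sqr_ge0 //.
      by apply: lerXn2r; rewrite ?nnegrE ?sqr_ge0 //; lra.
    by rewrite -exprM mulrC (uwl 4%N 26%N); exact: wX.
  have -> : - p ^+ 4 * M + lam * mu ^+ 2 / 2 =
     - (p ^+ 4 * M) + (p ^+ 2 * n) ^+ 2 / 2 + 2 * (p ^+ 2 * (p ^+ 2 * n) ^+ 2).
    by rewrite lamE muE; field.
  have h1' : - (p ^+ 4 * M) <= - ((p ^+ 2 * n) ^+ 2) / 2 + g * (p ^+ 2 * n) ^+ 2 / 2.
    have -> : - ((p ^+ 2 * n) ^+ 2) / 2 + g * (p ^+ 2 * n) ^+ 2 / 2 =
      - (p ^+ 4 * ((1 - g) * n ^+ 2 / 2)) by field.
    by rewrite lerN2.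
  have h3' : g * (L / 16) ^+ 2 = g * L ^+ 2 / 256 by field.
  lra.
rewrite mulrA -expRD.
have exi : expR (- p ^+ 4 * M + lam * mu ^+ 2 / 2) <= 1 + eps / 6.
  apply: (@le_trans _ _ (expR (eps / 12))); first by rewrite ler_expR.
  by have := expR_le1D2x (eps / 12) _ _; lra.
apply: (@le_trans _ _ ((1 + eps / 6) * (1 + eps / 3))); last nra.
apply: ler_pM; rewrite ?expR_ge0 // !addr_ge0 ?expR_ge0 //; first lra.
- by rewrite etaE; lra.
- by rewrite divr_ge0 ?etaE //; lra.
Qed.

(** * Choice of constants and conclusion *)

Lemma card_arrow_le (V : finType) (adj : rel V) : (#|{: arrow V adj}| <= #|V| ^ 2)%N.
Proof.
rewrite -mulnn -card_prod card_sub; exact: max_card.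
Qed.

Local Open Scope classical_set_scope.

Theorem theorem3p9 (R : realType) (f : nat -> R)
  (f_ge0 : forall n : nat, (0 < n)%N -> 0 <= f n)
  (f_lim : (fun n : nat => f n * (ln (n%:R : R)) ^+ 2) @ \oo --> (0 : R^o)) :
  forall eps : R, 0 < eps -> eps < 1 / 2 ->
  exists (n0 : nat) (delta : R), (0 < n0)%N /\ 0 < delta /\
    forall (V : finType) (adj : rel V), simple_graph adj ->
    let n := #|V| in
    let m := #|edges adj| in
    (n0 <= n)%N ->
    (1 - f n) * (n%:R ^+ 2) / 2 <= m%:R ->
    max_density R adj = m%:R / n%:R ->
    forall k : nat,
      (1 + delta) * Num.sqrt (max_density R adj / ln (max_density R adj))
        <= k%:R ->
      1 - eps <= prob_colorable R adj k.
Proof.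
move=> eps e0 e1.
have [N1 _ fN1] : \forall n \near \oo, `|f n * ln (n%:R : R) ^+ 2| <= eps.
  by move/cvgrPdist_le : f_lim => /(_ _ e0); apply: filterS => n; rewrite sub0r normrN.
(* n >= U^32 amounts to n^(1/32) >= (100 / eps)^2, the largeness demanded of [u]. *)
pose U := ((eps / 100) ^+ 2)^-1.
have U0 : 0 < U by rewrite invr_gt0 exprn_gt0 // divr_gt0.
pose N2 := Num.Def.archi_bound (U ^+ 32).
have UN2 : U ^+ 32 <= N2%:R by apply/ltW/archi_boundP/exprn_ge0/ltW.
(* n >= 5 gives ln n >= 1 and, with rho >= n / 4, also rho > 1. The value 7 makes (1 + delta)^2 =
   64, so that 64 rho >= 16 n. *)
exists (maxn (maxn N1 N2) 5), 7; split; first by rewrite leq_max orbT.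
split => // V adj simple n m; rewrite !geq_max => /andP[/andP[nN1 nN2] n5] mge rhoE k.
rewrite rhoE => kge.
have n0 : 0 < n%:R :> R by rewrite ltr0n (leq_trans _ n5).
have n5R : 5 <= n%:R :> R by rewrite ler_nat.
pose L : R := ln n%:R.
have nE : n%:R = expR L by rewrite lnK // posrE.
have L1 : 1 <= L by rewrite -ler_expR -nE; apply: le_trans (expR1_le4 R) _; lra.
have g0 : 0 <= f n by apply: f_ge0; rewrite -(ltr0n R).
have gL : f n * L ^+ 2 <= eps by apply: le_trans (ler_norm _) (fN1 _ nN1).
(* As L >= 1, the bound f(n) L^2 <= eps < 1/2 already bounds f(n), so the graph is dense and rho >=
   n / 4. *)
have g2 : f n <= 1 / 2.
  have : f n * 1 <= f n * L ^+ 2 by rewrite ler_wpM2l // exprn_ege1.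
  lra.
have mn2 : m%:R <= n%:R ^+ 2 :> R.
  rewrite -natrX ler_nat (leq_trans (card_edges_le_arrows V adj simple)) //.
  exact: card_arrow_le.
pose rho : R := m%:R / n%:R.
have rho_n : rho <= n%:R by rewrite ler_pdivrMr // -expr2.
have n_rho : n%:R / 4 <= rho.
  rewrite ler_pdivlMr //; apply: le_trans mge.
  have := ler_wpM2r (sqr_ge0 (n%:R : R)) g2; rewrite expr2; lra.
have rho1 : 1 < rho by lra.
have lnr0 : 0 < ln rho by exact: ln_gt0.
have lnrL : ln rho <= L by rewrite ler_ln ?posrE //; lra.
have kL : 16 * n%:R <= k%:R ^+ 2 * L.
  have h0 : 0 <= rho / ln rho by rewrite divr_ge0 //; lra.
  have h1 : (8 * Num.sqrt (rho / ln rho)) ^+ 2 <= k%:R ^+ 2.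
    have s0 := sqrtr_ge0 (rho / ln rho).
    by apply: lerXn2r; rewrite ?nnegrE; [lra | exact: ler0n | move: kge; rewrite -/rho; lra].
  rewrite exprMn sqr_sqrtr // in h1.
  have h2 : 64 * rho <= k%:R ^+ 2 * ln rho.
    have := ler_wpM2r (ltW lnr0) h1.
    by rewrite -mulrA divfK ?gt_eqF // expr2; lra.
  have := ler_wpM2l (sqr_ge0 (k%:R : R)) lnrL; lra.
have k0 : (0 < k)%N.
  rewrite lt0n; apply/eqP => k0; move: kL; rewrite k0 expr0n /= mul0r; lra.
have k0R : 0 < k%:R :> R by rewrite ltr0n.
have uU : 1 <= (eps / 100) ^+ 2 * expR (L / 32).
  rewrite -ler_pdivrMl ?exprn_gt0 ?divr_gt0 // mulr1 -/U.
  rewrite -(@ler_pXn2r _ 32) ?nnegrE ?expR_ge0 ?(ltW U0) // -expRM_natl.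
  have -> : 32%:R * (L / 32) = L by field.
  by rewrite -nE (le_trans UN2) // ler_nat.
pose p : R := k%:R^-1.
have p0 : 0 <= p by rewrite invr_ge0 ltW.
have pL : p ^+ 2 * (16 * n%:R) <= L.
  by rewrite exprVn ler_pdivrMl // exprn_gt0.
have L0 : 0 <= L by lra.
have mM : (1 - f n) * n%:R ^+ 2 / 2 <= #|{: arrow V adj}|%:R.
  by apply: le_trans mge _; rewrite ler_nat card_edges_le_arrows.
have [th ratio] := second_moment_ratio_le R eps n%:R L _ p (f n) _ _ _ _ _ _ _
  e0 e1 L0 nE erefl uU p0 pL g0 gL mM erefl erefl erefl erefl erefl erefl.
(* For k = 1, [kL] would read 16 n <= ln n. *)
have k2 : (2 <= k)%N.
  rewrite ltnNge; apply/negP => k1.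
  have kE : k = 1%N by apply/eqP; rewrite eqn_leq k1 k0.
  have := ln_sublinear n0; rewrite -/L => Ln.
  by move: kL; rewrite kE expr1n mul1r; lra.
have eps1 : 0 < 1 + eps by lra.
apply: (@le_trans _ _ (1 + eps)^-1).
  rewrite -[leRHS]mul1r ler_pdivlMr //.
  by have := sqr_ge0 eps; rewrite expr2; lra.
apply: (prob_colorable_ge R V adj simple k p _ k2 erefl eps1).
set th' := _ * (_ + _) / 2 in th ratio.
have mu0 : 0 <= expR (L / 32) ^+ 20 by rewrite exprn_ge0 ?expR_ge0.
have lam0 : 0 <= p ^+ 2 + 4 * p ^+ 4.
  by rewrite addr_ge0 ?mulr_ge0 ?exprn_ge0.
have eta0 : 0 < eps / 8 by lra.
have sum_le := agree_quadratic_le R V k _ _ _ th' _ _ k0 lam0 eta0 mu0 erefl erefl th erefl.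
apply: le_trans (ler_wpM2l (expR_ge0 _) sum_le) _.
rewrite -[_ * _ * (_ + _)]mulrA mulrCA.
by apply: ler_wpM2l; first exact: exprn_ge0.
Qed.
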